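(* Let $q$ be a prime power, let $d\ge 2$ and $m$ be integers with $2d\le m$, and let $C\le \mathbb{F}_{q^m}^{2d}$ be an $\mathbb{F}_{q^m}$-linear $[2d,d,d]$ rank metric code (length $2d$, $\mathbb{F}_{q^m}$-dimension $d$, minimum rank distance $d$) which is dually AMRD and satisfies $A_{d+1}(C)=0$. Then the elements of the set $D_d(C)$ are the blocks of an $S_q(d-1,d,2d)$ Steiner system; that is, $D_d(C)$ is a set of $d$-dimensional subspaces of $\mathbb{F}_q^{2d}$ such that every $(d-1)$-dimensional subspace of $\mathbb{F}_q^{2d}$ is contained in exactly one element of $D_d(C)$.
   Context: The field $\mathbb{F}_{q^m}$ is regarded as an $m$-dimensional vector space over $\mathbb{F}_q$. The rank weight of $v=(v_1,\dots,v_n)\in\mathbb{F}_{q^m}^n$ is $\mathrm{wt}(v)=\dim_{\mathbb{F}_q}\langle v_1,\dots,v_n\rangle_{\mathbb{F}_q}$, and the rank distance between $u$ and $v$ is $\mathrm{wt}(u-v)$. An $[n,k,\delta]$ $\mathbb{F}_{q^m}$-linear rank metric code is a $k$-dimensional $\mathbb{F}_{q^m}$-subspace $C\le\mathbb{F}_{q^m}^n$ with minimum distance $\delta=\min\{\mathrm{wt}(c)\mid 0\ne c\in C\}$; here $n\le m$ is assumed. $A_i(C)$ denotes the number of codewords of $C$ of rank weight $i$. The rank defect of an $[n,k,\delta]$ code is $\mathrm{def}(C)=n-k+1-\delta$. $C^\perp$ is the orthogonal of $C$ with respect to the standard inner product of $\mathbb{F}_{q^m}^n$. $C$ is called dually AMRD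 (dually almost MRD) if $\mathrm{def}(C)=\mathrm{def}(C^\perp)=1$. Support: fix a basis $B=(b_1,\dots,b_m)$ of $\mathbb{F}_{q^m}$ over $\mathbb{F}_q$, write $v_i=\sum_{j=1}^m \alpha_{ji}b_j$ with $\alpha_{ji}\in\mathbb{F}_q$, and put $M_B(v)=(\alpha_{ji})\in\mathbb{F}_q^{m\times n}$. Then $\mathrm{supp}(v)\subseteq\mathbb{F}_q^n$ is the $\mathbb{F}_q$-linear row space of $M_B(v)$; it does not depend on the choice of $B$. Put $D_d(C)=\{\mathrm{supp}(c)\mid c\in C,\ \mathrm{wt}(c)=d\}$. For integers $t\le k\le n$, a $q$-Steiner system $S_q(t,k,n)$ is a set of $k$-dimensional subspaces of $\mathbb{F}_q^n$, called blocks, such that every $t$-dimensional subspace of $\mathbb{F}_q^n$ is contained in exactly one block. *)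

(* Defs.v *)
From mathcomp Require Import all_boot all_order all_algebra all_field.

Set Implicit Arguments.
Unset Strict Implicit.
Unset Printing Implicit Defensive.

Import GRing.Theory.
Local Open Scope ring_scope.

(* F plays the role of F_q and L that of F_{q^m}, with m = \dim {:L}.  Since a
   fieldExtType over a finite field carries no canonical finType structure,
   finite enumerations of words go through the alias [finvect_type L]. *)

Section RankMetricCodes.

Variables (F : finFieldType) (L : fieldExtType F) (n : nat).

Implicit Types (v : 'rV[L]_n) (C : {vspace 'rV[L]_n}) (U : {vspace 'rV[F]_n}).

Definition rank_wt v : nat := \dim <<[seq v 0%R i | i : 'I_n]>>%VS.

(* The value on the zero code, which has no nonzero word, is n.+1; it never
   interferes with an actual minimum because rank_wt v <= n. *)
Definition min_dist C : nat :=
  \big[minn/n.+1]_(c : 'rV[finvect_type L]_n | (c \in C) && (c != 0)) rank_wt c.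

Definition num_words C (i : nat) : nat :=
  #|[set c : 'rV[finvect_type L]_n | (c \in C) && (rank_wt c == i)]|.

(* v *m c^T is the 1 x 1 matrix holding the standard inner product of v and c,
   and mulmxr c^T maps v to it. *)
Definition dual_code C : {vspace 'rV[L]_n} :=
  (\bigcap_(c : 'rV[finvect_type L]_n | c \in C)
     lker (linfun (mulmxr (c : 'rV[L]_n)^T : 'rV[L]_n -> 'rV[L]_1)))%VS.

Definition rank_defect C : int :=
  n%:Z - (\dim C)%:Z + 1 - (min_dist C)%:Z.

Definition dually_AMRD C : Prop :=
  rank_defect C = 1 /\ rank_defect (dual_code C) = 1.

Definition coord_mx m (B : m.-tuple L) v : 'M[F]_(m, n) :=
  \matrix_(j, i) coord B j (v 0 i).

Definition supp m (B : m.-tuple L) v : {vspace 'rV[F]_n} :=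
  <<[seq row j (coord_mx B v) | j : 'I_m]>>%VS.

Definition supports m (B : m.-tuple L) C (d : nat) : {pred {vspace 'rV[F]_n}} :=
  [pred U | [exists c : 'rV[finvect_type L]_n,
     [&& c \in C, rank_wt c == d & supp B c == U]]].

Lemma rank_wt_le v : (rank_wt v <= n)%N.
Proof. by rewrite (leq_trans (dim_span _)) // size_map -cardE card_ord. Qed.

Lemma min_distP C : C != 0%VS ->
  (exists c, [/\ c \in C, c != 0 & rank_wt c = min_dist C])
  /\ (forall c, c \in C -> c != 0 -> (min_dist C <= rank_wt c)%N).
Proof.
move=> C0.
have lb c : c \in C -> c != 0 -> (min_dist C <= rank_wt c)%N.
  rewrite /min_dist => cC c0.
  have : (c : 'rV[finvect_type L]_n) \in index_enum 'rV[finvect_type L]_n.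
    exact: mem_index_enum.
  elim: (index_enum _) => // x s IH; rewrite inE big_cons => /orP[/eqP <-|cs].
    have -> : (c \in C) && ((c : 'rV[finvect_type L]_n) != 0).
      by apply/andP; split.
    exact: geq_minl.
  by case: ifP => _; [rewrite geq_min IH ?orbT | apply: IH].
split=> //.
have [//|E] : (exists c, [/\ c \in C, c != 0 & rank_wt c = min_dist C])
              \/ min_dist C = n.+1.
  rewrite /min_dist; elim/big_rec: _ => [|c x /andP[cC c0] IH]; first by right.
  by rewrite /minn; case: ifP => _ //; left; exists c.
have := lb (vpick C) (memv_pick C).
by rewrite vpick0 C0 E ltnNge rank_wt_le => /(_ isT).
Qed.

Lemma mem_dual_codeP C v :
  v \in dual_code C <-> (forall c, c \in C -> \sum_i v 0 i * c 0 i = 0).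
Proof.
have ip c : (v *m c^T) 0 0 = \sum_i v 0 i * c 0 i.
  by rewrite mxE; apply: eq_bigr => i _; rewrite mxE.
rewrite memvE; split.
  move/subv_bigcapP => H c cC; have := H (c : 'rV[finvect_type L]_n) cC.
  by rewrite -memvE memv_ker lfunE /= -ip => /eqP ->; rewrite mxE.
move=> H; apply/subv_bigcapP => c cC.
rewrite -memvE memv_ker lfunE /=; apply/eqP/rowP => i.
by rewrite ord1 ip H // mxE.
Qed.

End RankMetricCodes.

Definition steiner_system (F : finFieldType) (t k n : nat)
    (D : {pred {vspace 'rV[F]_n}}) : Prop :=
  [/\ (t <= k <= n)%N,
      forall U : {vspace 'rV[F]_n}, U \in D -> \dim U = k
    & forall T : {vspace 'rV[F]_n}, \dim T = t ->
        exists! U : {vspace 'rV[F]_n}, U \in D /\ (T <= U)%VS].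

(* Main.v *)
From HB Require Import structures.
Require Import Defs.
From mathcomp Require Import all_boot all_order all_algebra all_field.
From mathcomp Require Import zify.

(** Write n = 2d and call the supports of the words of C of weight d blocks.
    After extension of scalars to L, a subspace T of F^n becomes a subspace
    T_L of L^n, and a word c lies in T_L exactly when supp c <= T.  The
    argument has two halves.

    - Let dim T = d+1.  A vector orthogonal to both C and T_L is a word of the
      dual code of weight at most n - dim T = d-1, hence zero, because the dual
      code, like C, has minimum distance d.  So C + T_L = L^n, and C meets T_L
      in a space of L-dimension d + (d+1) - 2d = 1.  A word spanning it has
      weight d, since d+1 is excluded, and its nonzero multiples all have the
      same support.  Therefore every (d+1)-dimensional space contains exactly
      one block ([exists_unique_support]).

    - This dual Steiner property already gives the theorem
      ([dual_steiner]).  Two blocks through a common (d-1)-dimensional space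
      would span a (d+1)-dimensional space containing both, so a
      (d-1)-dimensional space T lies in r T <= 1 blocks.  Orthogonality with
      respect to a nondegenerate bilinear form shows that F^n has as many
      (d+1)-dimensional as (d-1)-dimensional subspaces; a form for which the
      block U is its own orthogonal shows that U lies in as many
      (d+1)-dimensional spaces as it contains (d-1)-dimensional ones.
      Counting incidences between blocks and (d+1)-dimensional spaces, then
      between blocks and (d-1)-dimensional spaces, bounds the sum of r from
      below by the number of (d-1)-dimensional spaces, which forces r T = 1
      for all T. *)

Set Implicit Arguments.
Unset Strict Implicit.
Unset Printing Implicit Defensive.

Import GRing.Theory.
Local Open Scope ring_scope.

(** * Row spaces and orthogonality *)

Section RowSpaces.

Variables (K : fieldType) (n : nat).

Definition row_space m (A : 'M[K]_(m, n)) : {vspace 'rV[K]_n} :=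
  <<[seq row i A | i : 'I_m]>>%VS.

Definition basis_mx (U : {vspace 'rV[K]_n}) : 'M[K]_(\dim U, n) :=
  \matrix_i (vbasis U)`_i.

Lemma mem_row_space m (A : 'M[K]_(m, n)) v :
  (v \in row_space A) = (v <= A)%MS.
Proof.
apply/idP/idP => [|/submxP[u ->]].
  rewrite /row_space -[[seq _ | _ : _]]in_tupleE => /coord_span ->.
  apply: summx_sub => i _; apply: scalemx_sub.
  rewrite -tnth_nth.
  have /mapP[j _ ->] := mem_tnth i (in_tuple [seq row i A | i : 'I_m]).
  exact: row_sub.
rewrite mulmx_sum_row; apply: memv_suml => i _; apply/memvZ/memv_span.
exact: image_f.
Qed.

Lemma row_space_sub m1 m2 (A : 'M[K]_(m1, n)) (B : 'M[K]_(m2, n)) :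
  (row_space A <= row_space B)%VS = (A <= B)%MS.
Proof.
apply/subvP/row_subP => [sAB i | sAB v].
  by rewrite -mem_row_space sAB // mem_row_space row_sub.
by rewrite !mem_row_space => /submx_trans; apply; apply/row_subP.
Qed.

Lemma dim_row_space m (A : 'M[K]_(m, n)) : \dim (row_space A) = \rank A.
Proof.
have -> : row_space A = row_space (row_base A).
  by apply/eqP; rewrite eqEsubv !row_space_sub !eq_row_base submx_refl.
pose X := [tuple row i (row_base A) | i < \rank A].
have -> : row_space (row_base A) = <<X>>%VS by [].
suff /eqP -> : free X by rewrite size_tuple.
apply/freeP => k; under eq_bigr => i _ do rewrite -tnth_nth tnth_mktuple.
move=> kX0 i.
have: (\row_i k i) *m row_base A = 0.
  by rewrite mulmx_sum_row -[RHS]kX0; apply: eq_bigr => j _; rewrite mxE.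
move/eqP; rewrite mulmx_free_eq0 ?row_base_free // => /eqP/rowP/(_ i).
by rewrite !mxE.
Qed.

Lemma basis_mxK U : row_space (basis_mx U) = U.
Proof.
rewrite -[RHS](span_basis (vbasisP U)); apply: eq_span => v.
apply/imageP/idP => [[i _ ->]|/tnthP[i ->]].
  by rewrite rowK mem_nth // size_tuple.
by exists i; rewrite // rowK (tnth_nth 0).
Qed.

Lemma mem_basis_mx (U : {vspace 'rV[K]_n}) v : (v \in U) = (v <= basis_mx U)%MS.
Proof. by rewrite -mem_row_space basis_mxK. Qed.

Lemma rank_basis_mx U : \rank (basis_mx U) = \dim U.
Proof. by rewrite -dim_row_space basis_mxK. Qed.

(** The orthogonal of U on the left of the bilinear form with Gram matrix g. *)
Definition annih (g : 'M[K]_n) (U : {vspace 'rV[K]_n}) : {vspace 'rV[K]_n} :=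
  row_space (kermx (g *m (basis_mx U)^T)).

Lemma annihP g (U : {vspace 'rV[K]_n}) (x : 'rV[K]_n) :
  reflect (forall u, u \in U -> x *m g *m u^T = 0) (x \in annih g U).
Proof.
rewrite mem_row_space; apply: (iffP sub_kermxP); rewrite mulmxA;
  [move=> xU0 u | move=> xU0].
  rewrite mem_basis_mx => /submxP[y ->].
  by rewrite trmx_mul mulmxA xU0 mul0mx.
apply/rowP => i; have := xU0 (row i (basis_mx U)).
rewrite mem_basis_mx row_sub => /(_ isT)/matrixP/(_ 0 0).
move=> E; rewrite [RHS]mxE; rewrite [RHS]mxE in E; rewrite -E [LHS]mxE [RHS]mxE.
by apply: eq_bigr => k _; rewrite !mxE.
Qed.

Lemma dim_annih g U : g \in unitmx -> \dim (annih g U) = (n - \dim U)%N.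
Proof.
move=> g_unit; rewrite dim_row_space mxrank_ker.
by rewrite eqmxMfull ?row_full_unit // mxrank_tr rank_basis_mx.
Qed.

Lemma annihS g U V : (U <= V)%VS -> (annih g V <= annih g U)%VS.
Proof.
move=> /subvP sUV; apply/subvP => x /annihP xV0; apply/annihP => u /sUV.
exact: xV0.
Qed.

Lemma dim_row_vspace_le (U : {vspace 'rV[K]_n}) : (\dim U <= n)%N.
Proof. by rewrite (leq_trans (dimvS (subvf _))) // dimvf /dim /= mul1n. Qed.

Lemma annihK g : g \in unitmx -> cancel (annih g) (annih g^T).
Proof.
move=> g_unit U; apply/esym/eqP; rewrite eqEdim; apply/andP; split.
  apply/subvP => u uU; apply/annihP => x /annihP/(_ u uU) xu0.
  by apply: trmx_inj; rewrite !trmx_mul !trmxK mulmxA xu0 trmx0.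
by rewrite !dim_annih ?unitmx_tr // subKn ?dim_row_vspace_le.
Qed.

(** Both matrices factor through a partial identity by invertible changes of
    coordinates, and g turns the row coordinates of A into those of B. *)
Lemma exists_unitmx_sub m1 m2 (A : 'M[K]_(m1, n)) (B : 'M[K]_(m2, n)) :
  (\rank A <= \rank B)%N -> exists2 g, g \in unitmx & (A *m g <= B)%MS.
Proof.
move=> leAB; exists (invmx (row_ebase A) *m row_ebase B).
  by rewrite unitmx_mul unitmx_inv !row_ebase_unit.
rewrite -{1}[A]mulmx_ebase mulmxA mulmxK ?row_ebase_unit // -mulmxA.
have -> : pid_mx (\rank A) =
    pid_mx (\rank A) *m (pid_mx (\rank B) : 'M[K]_(m2, n)) :> 'M[K]_(m1, n).
  rewrite mul_pid_mx (minn_idPl leAB).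
  by rewrite (minn_idPr (leq_trans leAB (rank_leq_row _))).
rewrite -(mulmxA (pid_mx _)).
have -> : pid_mx (\rank B) *m row_ebase B = invmx (col_ebase B) *m B.
  by rewrite -[X in _ = _ *m X]mulmx_ebase -mulmxA mulKmx ?col_ebase_unit.
by rewrite !mulmxA submxMl.
Qed.

(** An invertible g that maps U into its orthogonal for the standard form makes
    U totally isotropic for the form g, and a totally isotropic space of half
    the dimension is its own orthogonal. *)
Lemma exists_annih_fixed (U : {vspace 'rV[K]_n}) :
  (\dim U + \dim U = n)%N -> exists2 g, g \in unitmx & annih g U = U.
Proof.
move=> dimU; set A := basis_mx U.
have [|g g_unit /sub_kermxP AgA0] := @exists_unitmx_sub _ _ A (kermx A^T).
  by rewrite mxrank_ker mxrank_tr rank_basis_mx -{3}dimU addnK.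
exists g => //; apply/esym/eqP; rewrite eqEdim dim_annih //.
rewrite -{3}dimU addnK leqnn andbT; apply/subvP => u; rewrite mem_basis_mx => /submxP[y ->].
apply/annihP => v; rewrite mem_basis_mx => /submxP[z ->].
rewrite trmx_mul -!mulmxA [g *m _]mulmxA [A *m _]mulmxA [A *m _]mulmxA AgA0.
by rewrite mul0mx mulmx0.
Qed.

End RowSpaces.

(** * Steiner systems from dual Steiner systems *)

Section FiniteSubspaces.

Variables (F : finFieldType) (vT : vectType F).

HB.instance Definition _ := isCountable.Build {vspace vT}
  (pcan_pickleK (can_pcan (@VectorInternalTheory.vs2mxK F vT))).
HB.instance Definition _ := isFinite.Build {vspace vT}
  (pcan_enumP (can_pcan (@VectorInternalTheory.vs2mxK F vT))).

End FiniteSubspaces.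

Section DualSteiner.

Variables (F : finFieldType) (n : nat).

Implicit Types (U V T : {vspace 'rV[F]_n}).

Lemma leq_card_dim k l :
  (k + l = n)%N ->
  (#|[pred T : {vspace 'rV[F]_n} | \dim T == k]|
    <= #|[pred T : {vspace 'rV[F]_n} | \dim T == l]|)%N.
Proof.
move=> kl; have unit1 : (1%:M : 'M[F]_n) \in unitmx by exact: unitmx1.
rewrite -(card_image (can_inj (annihK unit1))); apply/subset_leq_card/subsetP.
move=> _ /imageP[T /eqP dimT ->]; rewrite inE dim_annih // dimT -kl.
by rewrite addKn.
Qed.

(** Orthogonality for a form fixing U reverses inclusions, so it sends the
    spaces above U to spaces below U. *)
Lemma leq_card_above_below U k l :
  (\dim U + \dim U = n)%N -> (k + l = n)%N ->
  (#|[pred T | (\dim T == k) && (U <= T)%VS]|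
    <= #|[pred T | (\dim T == l) && (T <= U)%VS]|)%N.
Proof.
move=> dimU kl; have [g g_unit gU] := exists_annih_fixed dimU.
rewrite -(card_image (can_inj (annihK g_unit))); apply/subset_leq_card/subsetP.
move=> _ /imageP[T /andP[/eqP dimT sUT] ->].
have nk : (n - k = l)%N by rewrite -kl addKn.
by rewrite inE dim_annih // dimT nk eqxx -[X in (_ <= X)%VS]gU annihS.
Qed.

(** No (d-1)-dimensional space lies in two members of D, and counting incidences
    shows that it lies in one on average, hence always in exactly one. *)
Lemma dual_steiner d (D : {pred {vspace 'rV[F]_n}}) :
  (0 < d)%N -> (d + d = n)%N -> (forall U, U \in D -> \dim U = d) ->
  (forall T, \dim T = d.+1 -> exists! U, U \in D /\ (U <= T)%VS) ->
  steiner_system d.-1 d D.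
Proof.
move=> d_gt0 dn dimD uniqD.
have dn' : (d.-1 + d.+1 = n)%N by rewrite addnS -addSn prednK.
(* Distinct U and V meeting in a (d-1)-dimensional space have a
   (d+1)-dimensional sum, which contains only one member of D. *)
have meet T U V : \dim T = d.-1 -> U \in D -> V \in D ->
    (T <= U)%VS -> (T <= V)%VS -> U = V.
  move=> dimT DU DV sTU sTV; have [dU dV] := (dimD U DU, dimD V DV).
  have dimUV : (\dim (U + V) <= d.+1)%N.
    have sTUV : (T <= U :&: V)%VS by rewrite subv_cap sTU.
    rewrite -(leq_add2r (\dim (U :&: V))) dimv_sum_cap dU dV.
    rewrite -{2}(prednK d_gt0) addnS -addSn leq_add2l -dimT.
    exact: dimvS.
  move: dimUV; rewrite leq_eqVlt ltnS => /orP[/eqP dimUV | dimUV].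
    have [W [_ uniqW]] := uniqD _ dimUV.
    by rewrite -(uniqW U) ?(uniqW V) ?addvSl ?addvSr.
  have UVE X : \dim X = d -> (X <= U + V)%VS -> X = (U + V)%VS.
    by move=> dimX sX; apply/eqP; rewrite eqEdim sX dimX.
  by rewrite (UVE U dU (addvSl _ _)) -(UVE V dV (addvSr _ _)).
pose r T := #|[pred U in D | (T <= U)%VS]|.
have r_le1 T : \dim T = d.-1 -> (r T <= 1)%N.
  move=> dimT; apply/card_le1P => U /andP[DU sTU] V; rewrite !inE.
  apply/andP/eqP => [[DV sTV] | ->]; first exact: (meet T).
  by split.
have count_up : (#|[pred T : {vspace 'rV[F]_n} | \dim T == d.+1]|
    = \sum_(U in D) #|[pred T | (\dim T == d.+1) && (U <= T)%VS]|)%N.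
  rewrite -sum1_card.
  under [RHS]eq_bigr => U _ do rewrite -sum1_card big_mkcondr.
  rewrite exchange_big; apply: eq_bigr => T /eqP dimT.
  have [U [[DU sUT] uniqU]] := uniqD T dimT.
  rewrite (bigD1 U) //= sUT big1 ?addn0 // => V /andP[DV neVU].
  by case: ifP => // sVT; case/eqP: neVU; apply/esym/uniqU.
have count_down : (\sum_(U in D) #|[pred T | (\dim T == d.-1) && (T <= U)%VS]|
    = \sum_(T : {vspace 'rV[F]_n} | \dim T == d.-1) r T)%N.
  under eq_bigr => U _ do rewrite -sum1_card big_mkcondr.
  rewrite exchange_big; apply: eq_bigr => T _.
  by rewrite /r -sum1_card [RHS]big_mkcondr.
have leX : (\sum_(T : {vspace 'rV[F]_n} | \dim T == d.-1) 1 <=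
    \sum_(T : {vspace 'rV[F]_n} | \dim T == d.-1) r T)%N.
  rewrite sum1_card -count_down (leq_trans (leq_card_dim dn')) // count_up.
  apply: leq_sum => U DU; apply: leq_card_above_below; first by rewrite dimD.
  by rewrite addnC.
split=> [||T dimT]; first by rewrite leq_pred -dn leq_addr.
  exact: dimD.
have [U /andP[DU sTU]]: exists U, U \in [pred U in D | (T <= U)%VS].
  apply/card_gt0P; rewrite -/(r T).
  have /leqif_sum : forall T' : {vspace 'rV[F]_n}, \dim T' == d.-1 ->
      (r T' <= 1 ?= iff (r T' == 1))%N.
    by move=> T' /eqP dimT'; split; first exact: r_le1.
  case=> ge_sum /esym; rewrite eqn_leq ge_sum leX => /forall_inP.
  by move=> /(_ T); rewrite dimT eqxx => /(_ isT)/eqP ->.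
exists U; split=> // V [DV sTV]; exact: (meet T).
Qed.

End DualSteiner.

(** * Supports of words *)

Section Support.

Variables (F : finFieldType) (L : fieldExtType F) (n m : nat) (B : m.-tuple L).
Hypothesis basisB : basis_of {:L} B.

Implicit Types (v : 'rV[L]_n).

Definition basis_row : 'rV[L]_m := \row_j B`_j.

Lemma basis_row_coord_mx v :
  basis_row *m map_mx (in_alg L) (coord_mx B v) = v.
Proof.
apply/rowP => i; rewrite mxE [RHS](coord_basis basisB (memvf _)).
by apply: eq_bigr => j _; rewrite !mxE mulr_algr.
Qed.

Lemma coord_mx_mul p (y : 'rV[L]_p) (A : 'M[F]_(p, n)) :
  coord_mx B (y *m map_mx (in_alg L) A) = coord_mx B y *m A.
Proof.
apply/matrixP => j i; rewrite !mxE linear_sum; apply: eq_bigr => k _.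
by rewrite !mxE mulr_algr linearZ /= mulrC.
Qed.

(** This turns containment of supports, an F-linear condition, into membership
    in an L-subspace, which can then be intersected with a code. *)
Lemma supp_sub v p (A : 'M[F]_(p, n)) :
  (supp B v <= row_space A)%VS = (v <= map_mx (in_alg L) A)%MS.
Proof.
rewrite -[supp B v]/(row_space (coord_mx B v)) row_space_sub.
apply/idP/submxP => [sBA | [y ->]]; last by rewrite coord_mx_mul submxMl.
have /submxP[X eX] := sBA.
exists (basis_row *m map_mx (in_alg L) X).
by rewrite -mulmxA -map_mxM -eX basis_row_coord_mx.
Qed.

Definition coord_row (x : L) : 'rV[F]_m := \row_j coord B j x.

Fact coord_row_linear : linear coord_row.
Proof. by move=> a x y; apply/rowP => j; rewrite !mxE linearP. Qed.

HB.instance Definition _ :=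
  GRing.isLinear.Build F L 'rV[F]_m _ coord_row coord_row_linear.

(** The coordinate map L -> F^m sends the entries of v to the columns of
    coord_mx B v, so the weight is the column rank of that matrix while supp is
    its row space. *)
Lemma dim_supp v : \dim (supp B v) = rank_wt v.
Proof.
have inj_coord : lker (linfun coord_row) = 0%VS.
  apply/eqP/lker0P => x y; rewrite !lfunE /= => /rowP eq_xy.
  rewrite (coord_basis basisB (memvf x)) (coord_basis basisB (memvf y)).
  by apply: eq_bigr => j _; have:= eq_xy j; rewrite !mxE => ->.
rewrite /rank_wt -[RHS](@limg_dim_eq _ _ _ (linfun coord_row)); last first.
  by rewrite inj_coord capv0.
rewrite -[supp B v]/(row_space (coord_mx B v)) dim_row_space -mxrank_tr.
rewrite -dim_row_space.
congr (\dim _); rewrite limg_span -map_comp; congr (<<_>>)%VS.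
by apply: eq_map => i; rewrite /= lfunE; apply/rowP => j; rewrite !mxE.
Qed.

End Support.

(** * Codes whose dual has large minimum distance *)

Section Code.

Variables (F : finFieldType) (L : fieldExtType F) (n m : nat) (B : m.-tuple L).
Hypothesis basisB : basis_of {:L} B.

Implicit Types (C : {vspace 'rV[L]_n}) (T : {vspace 'rV[F]_n}).

(** A vector orthogonal to both summands is a word of the dual code whose
    support is orthogonal to T, so its weight is at most n - \dim T. *)
Lemma rank_code_add_full C T :
  (forall c, c \in dual_code C -> c != 0 -> (n - \dim T < rank_wt c)%N) ->
  \rank (basis_mx C + map_mx (in_alg L) (basis_mx T))%MS = n.
Proof.
move=> wt_gt; set A := basis_mx T; set S := (_ + _)%MS.
have ker0 : kermx S^T = 0.
  apply/row_matrixP => i; rewrite row0; set w := row i _.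
  have wS0 : w *m S^T = 0 by apply/sub_kermxP/row_sub.
  have wM0 p (M : 'M[L]_(p, n)) : (M <= S)%MS -> w *m M^T = 0.
    by case/submxP => X ->; rewrite trmx_mul mulmxA wS0 mul0mx.
  have wC : w \in dual_code C.
    apply/mem_dual_codeP => c; rewrite mem_basis_mx => cC.
    have /wM0/matrixP/(_ 0 0): (c <= S)%MS.
      exact: submx_trans cC (addsmxSl _ _).
    have ip : (w *m c^T) 0 0 = \sum_k w 0 k * c 0 k.
      by rewrite mxE; apply: eq_bigr => k _; rewrite [c^T _ _]mxE.
    move=> E; rewrite [RHS]mxE ip in E; exact: E.
  apply/eqP; apply: contraT => w_neq0.
  have := wt_gt _ wC w_neq0; rewrite ltnNge; case/negP.
  have := wM0 _ _ (addsmxSr _ _ : (map_mx (in_alg L) A <= S)%MS).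
  rewrite map_trmx => /(congr1 (coord_mx B)); rewrite coord_mx_mul => wA0.
  have {wA0} /sub_kermxP wA0 : coord_mx B w *m A^T = 0.
    by rewrite wA0; apply/matrixP => j k; rewrite !mxE linear0.
  rewrite -(dim_supp basisB) [\dim (supp _ _)]dim_row_space.
  by rewrite (leq_trans (mxrankS wA0)) // mxrank_ker mxrank_tr rank_basis_mx.
apply/eqP; rewrite -mxrank_tr eqn_leq rank_leq_row -subn_eq0 -mxrank_ker ker0.
by rewrite mxrank0.
Qed.

Lemma dim_dual_code_le C : (\dim (dual_code C) <= n - \dim C)%N.
Proof.
rewrite -(dim_annih C (unitmx1 _ n)) dimvS //.
apply/subvP => v /mem_dual_codeP vC0.
apply/annihP => c /vC0 ip0; rewrite mulmx1; apply/rowP => i.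
rewrite ord1 [RHS]mxE -[RHS]ip0 mxE.
by apply: eq_bigr => k _; rewrite [c^T _ _]mxE.
Qed.

Lemma min_dist_le C c : c \in C -> c != 0 -> (min_dist C <= rank_wt c)%N.
Proof.
move=> cC c_neq0; have C_neq0 : C != 0%VS.
  by apply: contraNneq c_neq0 => C0; move: cC; rewrite C0 memv0.
by have [_] := min_distP C_neq0; apply.
Qed.

Lemma num_words_eq0 C i c : num_words C i = 0%N -> c \in C -> rank_wt c != i.
Proof.
move=> /cards0_eq no_word cC; apply/negP => wtc.
have := in_set0 (c : 'rV[finvect_type L]_n).
by rewrite -no_word inE cC wtc.
Qed.

(** The dimension count makes the words of C supported in T an L-line, so all
    of them are multiples of one word c and have the support of c. *)
Lemma exists_unique_support d C T :
  (\dim C + \dim T = n.+1)%N -> \dim T = d.+1 ->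
  (forall c, c \in C -> c != 0 -> (d <= rank_wt c)%N) ->
  (forall c, c \in C -> rank_wt c != d.+1) ->
  (forall c, c \in dual_code C -> c != 0 -> (n - \dim T < rank_wt c)%N) ->
  exists! U : {vspace 'rV[F]_n}, U \in supports B C d /\ (U <= T)%VS.
Proof.
move=> dimCT dimT wt_ge wt_neq wt_dual.
set A := map_mx (in_alg L) (basis_mx T); pose S := (basis_mx C :&: A)%MS.
have rankS : \rank S = 1.
  have := mxrank_sum_cap (basis_mx C) A; rewrite rank_code_add_full // -/S.
  rewrite mxrank_map !rank_basis_mx dimCT => /eqP.
  by rewrite -addn1 eqn_add2l => /eqP.
have memS c : (c <= S)%MS = (c \in C) && (supp B c <= T)%VS.
  by rewrite sub_capmx -mem_basis_mx -(supp_sub basisB) basis_mxK.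
pose c := nz_row S.
have c_neq0 : c != 0 by rewrite nz_row_eq0 -mxrank_eq0 rankS.
have [cC suppT] : c \in C /\ (supp B c <= T)%VS.
  by apply/andP; rewrite -memS nz_row_sub.
have wtc : rank_wt c = d.
  apply/eqP; rewrite eqn_leq wt_ge // andbT -ltnS ltn_neqAle wt_neq //=.
  by rewrite -(dim_supp basisB) -dimT dimvS.
exists (supp B c); split.
  by split=> //; apply/existsP; exists c; rewrite cC wtc !eqxx.
move=> U [/existsP[c' /and3P[c'C /eqP wtc' /eqP <-]] suppT'].
apply/esym/eqP; rewrite eqEdim !dim_supp // wtc wtc' leqnn andbT.
have sSc : (S <= c)%MS.
  have /mxrank_leqif_sup := nz_row_sub S.
  by case=> _ /esym; rewrite rankS rank_rV c_neq0.
rewrite [X in (_ <= X)%VS]/supp supp_sub //.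
apply: submx_trans (submx_trans sSc _); first by rewrite memS c'C.
by rewrite -(supp_sub basisB).
Qed.

End Code.

Theorem theorem5p3 (F : finFieldType) (L : fieldExtType F) (d m : nat)
    (B : m.-tuple L) (C : {vspace 'rV[L]_(2 * d)}) :
  (2 <= d)%N ->
  (2 * d <= m)%N ->
  \dim {:L} = m ->
  basis_of {:L} B ->
  \dim C = d ->
  min_dist C = d ->
  dually_AMRD C ->
  num_words C d.+1 = 0%N ->
  steiner_system d.-1 d (supports B C d).
Proof.
move=> d_ge2 _ _ basisB dimC distC [_ dualC] no_dp1.
have d_gt0 : (0 < d)%N by apply: leq_trans d_ge2.
apply: dual_steiner => //; first by rewrite mul2n addnn.
  move=> U /existsP[c /and3P[_ /eqP wtc /eqP <-]].
  by rewrite (dim_supp basisB).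
(* The defect hypothesis reads min_dist (dual_code C) = 2d - dim (dual_code C),
   so the upper bound d on the dimension of the dual suffices. *)
have distC' : (d <= min_dist (dual_code C))%N.
  have := dim_dual_code_le C; rewrite dimC.
  by move: dualC; rewrite /rank_defect; lia.
move=> T dimT; apply: exists_unique_support => //; rewrite ?dimC ?dimT //.
- lia.
- by move=> c cC c_neq0; rewrite -[X in (X <= _)%N]distC min_dist_le.
- by move=> c; apply: num_words_eq0.
move=> c cC c_neq0; apply: leq_trans (min_dist_le cC c_neq0).
by apply: leq_trans distC'; lia.
Qed.
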